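(* Let $X \subset S^8$ be such that $A(X) \subseteq \{\pm\frac{1}{5}, \pm\frac{3}{5}\}$. Then $|X| \le 240$, and $|X| = 240$ only if $X \simeq X_9$.
   Context: $S^{n-1}$ is the unit sphere of $\mathbb{R}^n$ and $(\cdot,\cdot)$ the standard inner product. For $X \subseteq \mathbb{R}^n$, $A(X) := \{(x,x') \mid x,x' \in X,\ x \neq x'\}$. The norm of $x$ is $N(x) := (x,x)$, and for a lattice $L$, $S(L) := \{x \in L \mid N(x) = 2\}$ is the set of its roots. Let $e_1,\dots,e_8$ be the standard basis of $\mathbb{R}^8$, $\mathbf{1}$ the all-one vector of $\mathbb{R}^8$, $D_8$ the lattice generated over $\mathbb{Z}$ by the vectors $e_i \pm e_j$ ($1 \le i,j \le 8$), and $E_8$ the lattice generated over $\mathbb{Z}$ by $D_8$ and $\frac{1}{2}\mathbf{1}$. Define $$X_9 := \Bigl\{ \bigl[\sqrt{\tfrac{2}{5}}\, x, \sqrt{\tfrac{1}{5}}\bigr] \;\Big|\; x \in S(E_8) \Bigr\} \subset S^8,$$ where $[\cdot,\cdot]$ denotes concatenation of coordinates; $|X_9| = 240$. For $X, X' \subseteq S^{d-1}$, $X \simeq X'$ (equivalence) means that $X'$ can be obtained from $X$ by applying an orthogonal transformation of $\mathbb{R}^d$ and replacing some of the vectors by their opposites. *)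

(* Defs.v *)
From mathcomp Require Import all_boot all_order all_algebra.
From mathcomp Require Import all_classical all_reals.

Set Implicit Arguments.
Unset Strict Implicit.
Unset Printing Implicit Defensive.

Import Order.TTheory GRing.Theory Num.Theory.

Local Open Scope classical_set_scope.
Local Open Scope ring_scope.

Definition dotp (R : realType) (n : nat) (u v : 'rV[R]_n) : R :=
  \sum_(i < n) u 0 i * v 0 i.

(* The unit sphere of R^n, hence S^{n-1}. *)
Definition unit_sphere (R : realType) (n : nat) : set 'rV[R]_n :=
  [set x | dotp x x = 1].
Arguments unit_sphere : clear implicits.

Definition inner_products (R : realType) (n : nat) (X : set 'rV[R]_n) : set R :=
  [set a | exists x x' : 'rV[R]_n, [/\ X x, X x', x <> x' & a = dotp x x']].

Definition orthogonal_mx (R : realType) (n : nat) (Q : 'M[R]_n) : Prop :=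
  Q *m Q^T = 1%:M.

(* X' is the image of X under x |-> +- x Q, the sign s x being chosen
   independently for each vector. When X contains antipodal vectors, two of its
   points may be sent to the same point of X'. *)
Definition equivalent (R : realType) (n : nat) (X X' : set 'rV[R]_n) : Prop :=
  exists (Q : 'M[R]_n) (s : 'rV[R]_n -> bool),
    orthogonal_mx Q /\ X' = [set (-1) ^+ s x *: (x *m Q) | x in X].

(* The additive subgroup generated by a possibly infinite set G. *)
Definition int_span (V : zmodType) (G : set V) : set V :=
  [set v | exists (m : nat) (s : m.-tuple V),
     (forall i : 'I_m, G (tnth s i)) /\ inIntSpan s v].

Definition lattice_roots (R : realType) (n : nat) (L : set 'rV[R]_n) : set 'rV[R]_n :=
  [set x | L x /\ dotp x x = 2].

Definition std_basis (R : realType) (n : nat) (i : 'I_n) : 'rV[R]_n :=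
  delta_mx 0 i.
Arguments std_basis R {n} i.

Definition lattice_D8 (R : realType) : set 'rV[R]_8 :=
  int_span [set v : 'rV[R]_8 | exists i j : 'I_8,
    v = std_basis R i + std_basis R j \/ v = std_basis R i - std_basis R j].
Arguments lattice_D8 : clear implicits.

Definition lattice_E8 (R : realType) : set 'rV[R]_8 :=
  int_span (lattice_D8 R `|` [set 2^-1 *: const_mx 1]).
Arguments lattice_E8 : clear implicits.

Definition X9 (R : realType) : set 'rV[R]_9 :=
  [set (row_mx (Num.sqrt (2 / 5) *: x) (const_mx (Num.sqrt (1 / 5)) : 'rV[R]_1)
     : 'rV[R]_(8 + 1)) | x in lattice_roots (lattice_E8 R)].
Arguments X9 : clear implicits.

(* Main.v *)
Require Import Defs.
From mathcomp Require Import all_boot all_order all_algebra ring lra zify.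
From mathcomp Require Import all_classical all_reals finmap.

(* Rescale to Y = sqrt 5 X, so that the vectors have norm 5 and the products are
   1, -1, 3 or -3.  For x in Y consider the vectors t with t or -t in Y and
   (x, t) = 3.  If two of them have product -1, then u = t + t' - x is a unit
   vector with (u, w) = 1 or -1 for all w in Y, and, up to sign, w = u + sqrt 2 p
   where the vectors p in the hyperplane orthogonal to u have norm 2 and integral
   products; otherwise these t have mutual products 1 and 3 only, there are at
   most 45 of them by a two-distance bound, and comparing second moments gives
   |Y| <= 216.

   A set P of norm 2 vectors of R^8 with integral products has at most 240
   elements, again by second moments: 56 neighbours at most for each root.  If
   |P| = 240 then P contains every norm 2 vector having integral products with P,
   and counting gives orthogonal roots r, s such that r + s belongs to a frame of
   8 orthogonal norm 4 vectors congruent modulo twice the lattice of P; in the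
   coordinates of this frame P is S(E8). *)

Set Implicit Arguments.
Unset Strict Implicit.
Unset Printing Implicit Defensive.

Import Order.TTheory GRing.Theory Num.Theory.

Local Open Scope classical_set_scope.
Local Open Scope card_scope.
Local Open Scope ring_scope.

(** * The standard inner product *)

Lemma dotpE (R : realType) n (x y : 'rV[R]_n) : dotp x y = (x *m y^T) 0 0.
Proof. by rewrite mxE; apply: eq_bigr => i _; rewrite mxE. Qed.

Lemma dotpC (R : realType) n (x y : 'rV[R]_n) : dotp x y = dotp y x.
Proof. by apply: eq_bigr => i _; rewrite mulrC. Qed.

Lemma dotpDl (R : realType) n (x y z : 'rV[R]_n) :
  dotp (x + y) z = dotp x z + dotp y z.
Proof. by rewrite !dotpE mulmxDl mxE. Qed.

Lemma dotpNl (R : realType) n (x z : 'rV[R]_n) : dotp (- x) z = - dotp x z.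
Proof. by rewrite !dotpE mulNmx mxE. Qed.

Lemma dotpZl (R : realType) n a (x z : 'rV[R]_n) : dotp (a *: x) z = a * dotp x z.
Proof. by rewrite !dotpE -scalemxAl mxE. Qed.

Lemma dotpDr (R : realType) n (x y z : 'rV[R]_n) :
  dotp z (x + y) = dotp z x + dotp z y.
Proof. by rewrite dotpC dotpDl !(dotpC z). Qed.

Lemma dotpNr (R : realType) n (x z : 'rV[R]_n) : dotp z (- x) = - dotp z x.
Proof. by rewrite dotpC dotpNl (dotpC z). Qed.

Lemma dotpZr (R : realType) n a (x z : 'rV[R]_n) : dotp z (a *: x) = a * dotp z x.
Proof. by rewrite dotpC dotpZl (dotpC z). Qed.

Definition dotp_lin := (dotpDl, dotpDr, dotpNl, dotpNr, dotpZl, dotpZr).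

Lemma dotp_sqrD (R : realType) n (x y : 'rV[R]_n) :
  dotp (x + y) (x + y) = dotp x x + 2 * dotp x y + dotp y y.
Proof. rewrite !dotp_lin (dotpC y x); ring. Qed.

Lemma dotp_ge0 (R : realType) n (x : 'rV[R]_n) : 0 <= dotp x x.
Proof. by apply: sumr_ge0 => i _; rewrite -expr2 sqr_ge0. Qed.

Lemma dotp_eq0 (R : realType) n (x : 'rV[R]_n) : dotp x x = 0 -> x = 0.
Proof.
move=> /eqP; rewrite psumr_eq0 => [/allP x0|i _]; last by rewrite -expr2 sqr_ge0.
apply/rowP => i; have := x0 i (mem_index_enum _).
by rewrite mxE mulf_eq0 orbb => /eqP.
Qed.

Lemma dotp_CS (R : realType) n (x y : 'rV[R]_n) :
  dotp x y ^+ 2 <= dotp x x * dotp y y.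
Proof.
have [x0|x0] := eqVneq (dotp x x) 0.
  by rewrite (dotp_eq0 x0) -(scale0r (0 : 'rV[R]_n)) !dotpZl !mul0r expr0n.
have xx : 0 < dotp x x by rewrite lt0r x0 dotp_ge0.
rewrite -(ler_pM2l xx) -subr_ge0.
have -> : dotp x x * (dotp x x * dotp y y) - dotp x x * dotp x y ^+ 2 =
    dotp (dotp x x *: y - dotp x y *: x) (dotp x x *: y - dotp x y *: x).
  by rewrite !dotp_lin (dotpC y x); ring.
exact: dotp_ge0.
Qed.

Lemma dotp_mul_orth (R : realType) n (Q : 'M[R]_n) (x y : 'rV[R]_n) :
  Q *m Q^T = 1%:M -> dotp (x *m Q) (y *m Q) = dotp x y.
Proof. by move=> QQ; rewrite !dotpE trmx_mul !mulmxA -(mulmxA x) QQ mulmx1. Qed.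

(** * Second moments of finite families of vectors *)

Lemma mxtrace_mul_tr_ge0 (R : realType) m n (A : 'M[R]_(m, n)) :
  0 <= \tr (A *m A^T).
Proof.
apply: sumr_ge0 => i _; rewrite mxE; apply: sumr_ge0 => j _.
by rewrite mxE -expr2 sqr_ge0.
Qed.

(* With G the sum of the x^T x and P the projection onto the complement of the
   rows of E, one has G P = G, and the bound is tr (G - c P)^2 >= 0 for the
   optimal c. *)
Lemma frame_bound (R : realType) n k (E : 'M[R]_(k, n)) (s : seq 'rV[R]_n) :
    (k < n)%N -> E *m E^T = 1%:M -> {in s, forall x, x *m E^T = 0} ->
  (\sum_(x <- s) dotp x x) ^+ 2
    <= (n - k)%:R * \sum_(x <- s) \sum_(y <- s) dotp x y ^+ 2.
Proof.
move=> kn EE sE; pose G := \sum_(x <- s) x^T *m x.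
pose P := 1%:M - E^T *m E.
have GT : G^T = G.
  by rewrite /G raddf_sum; apply: eq_bigr => x _ /=; rewrite trmx_mul trmxK.
have PT : P^T = P by rewrite linearB /= trmx_mul trmxK trmx1.
have PP : P *m P = P.
  rewrite mulmxBl mul1mx mulmxBr mulmx1 mulmxA -(mulmxA _ E) EE mulmx1.
  by rewrite subrr subr0.
have GP : G *m P = G.
  rewrite /G mulmx_suml [LHS]big_seq [RHS]big_seq; apply: eq_bigr => x xs.
  by rewrite mulmxBr mulmx1 mulmxA -(mulmxA _ x) (sE x xs) mulmx0 mul0mx subr0.
have PG : P *m G = G by rewrite -[LHS]trmxK trmx_mul PT GT GP GT.
have trP : \tr P = (n - k)%:R.
  by rewrite linearB /= mxtrace1 mxtrace_mulC EE mxtrace1 natrB // ltnW.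
have trG : \tr G = \sum_(x <- s) dotp x x.
  rewrite /G raddf_sum; apply: eq_bigr => x _ /=.
  by rewrite mxtrace_mulC dotpE trace_mx11.
have trGG : \tr (G *m G) = \sum_(x <- s) \sum_(y <- s) dotp x y ^+ 2.
  rewrite /G mulmx_suml raddf_sum; apply: eq_bigr => x _ /=.
  rewrite mulmx_sumr raddf_sum; apply: eq_bigr => y _ /=.
  rewrite mulmxA mxtrace_mulC -(mulmxA x^T) (mulmxA y) trace_mx11.
  by rewrite mxE big_ord1 -!dotpE (dotpC y) expr2.
rewrite -trG -trGG.
set t := \tr G; set d : R := (n - k)%:R.
have d0 : 0 < d by rewrite ltr0n subn_gt0.
have := mxtrace_mul_tr_ge0 (G - (t / d) *: P).
have -> : (G - (t / d) *: P)^T = G - (t / d) *: P.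
  by rewrite linearB /= linearZ /= PT GT.
rewrite mulmxBl !mulmxBr -!scalemxAl -!scalemxAr.
have trB (A B : 'M[R]_n) : \tr (A - B) = \tr A - \tr B by rewrite linearB.
have trZ a (A : 'M[R]_n) : \tr (a *: A) = a * \tr A by rewrite linearZ.
rewrite GP PG PP !trB !trZ trP -/t -/d => h.
rewrite -subr_ge0; have -> : d * \tr (G *m G) - t ^+ 2 =
    d * (\tr (G *m G) - t / d * t - (t / d * t - t / d * (t / d * d))).
  by field; rewrite gt_eqF.
by rewrite mulr_ge0 // ltW.
Qed.

(** The case of an empty frame: [E] has no rows and the projection is the identity. *)
Lemma frame_bound_full (R : realType) n (c : R) (s : seq 'rV[R]_n.+1) :
    {in s, forall x, dotp x x = c} ->
  (c * (size s)%:R) ^+ 2 <= n.+1%:R * \sum_(x <- s) \sum_(y <- s) dotp x y ^+ 2.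
Proof.
move=> sc; have := @frame_bound R n.+1 0 0 s isT.
have -> : \sum_(x <- s) dotp x x = c * (size s)%:R.
  rewrite -sum1_size natr_sum mulr_sumr [LHS]big_seq [RHS]big_seq.
  by apply: eq_bigr => x xs; rewrite sc // mulr1.
rewrite subn0; apply; first by apply/matrixP => [[]].
by move=> x _; rewrite trmx0 mulmx0.
Qed.

(** * Quadratic forms in nine variables *)

(** Collects a product of two linear forms into the monomials with i <= j, which is how the
    dimension 45 enters. *)
Lemma sum_pairs_le (V : nmodType) n (F : 'I_n -> 'I_n -> V) :
  \sum_i \sum_j F i j =
  \sum_(p in [pred p : 'I_n * 'I_n | (p.1 <= p.2)%N])
     (if p.1 == p.2 then F p.1 p.2 else F p.1 p.2 + F p.2 p.1).
Proof.
rewrite pair_big /= (bigID [pred p : 'I_n * 'I_n | (p.1 <= p.2)%N]) /=.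
under [RHS]eq_bigr => p _.
  rewrite (_ : (if _ then _ else _) =
    F p.1 p.2 + (if p.1 != p.2 then F p.2 p.1 else 0)); last first.
    by case: eqP; rewrite ?addr0.
  over.
rewrite big_split /=; congr (_ + _).
rewrite -big_mkcondr /= (reindex_inj (inv_inj (@swap_pairK _ _))) /=.
apply: eq_bigl => p /=; rewrite -ltnNge ltn_neqAle andbC /= inE; congr (_ && _).
Qed.

Lemma card_pairs_le : #|[pred p : 'I_9 * 'I_9 | (p.1 <= p.2)%N]| = 45%N.
Proof.
rewrite -sum1_card.
rewrite -(pair_big_dep xpredT (fun i j : 'I_9 => (i <= j)%N) (fun _ _ => 1%N)) /=.
under eq_bigr do rewrite big_mkcond -(big_mkord xpredT (fun j => if (_ <= j)%N then 1%N else 0%N)).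
rewrite -(big_mkord xpredT (fun i => \sum_(0 <= j < 9) if (i <= j)%N then 1%N else 0%N)%N).
by rewrite unlock.
Qed.

(* The quadratic forms v |-> (v, y - x/3) (v, y - x) vanish on every z <> y of T
   but not on y, so they are linearly independent; quadratic forms on R^9 have
   dimension 45. *)
Lemma two_distance_bound (R : realType) (x : 'rV[R]_9) (T : seq 'rV[R]_9) :
    uniq T -> {in T, forall y, dotp y y = 5 /\ dotp x y = 3} ->
    {in T &, forall y z, y != z -> dotp y z = 1 \/ dotp y z = 3} ->
  (size T <= 45)%N.
Proof.
move=> uT T53 T13; pose y (a : 'I_(size T)) := T`_a.
have yT a : y a \in T by apply: mem_nth.
pose c a (i j : 'I_9) := (y a - 3^-1 *: x) 0 i * (y a - x) 0 j.
pose m := #|[pred p : 'I_9 * 'I_9 | (p.1 <= p.2)%N]|.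
(* Row a of [A] holds the coefficients of the form attached to [y a], column b of [B] the values of
   the monomials at [y b]. With d = (y a, y b) the entry of [A *m B] is (d - 1) (d - 3): it is (5 -
   1) (5 - 3) = 8 on the diagonal and 0 elsewhere. *)
pose A : 'M[R]_(size T, m) := \matrix_(a, k)
  let p := enum_val k in
  if p.1 == p.2 then c a p.1 p.2 else c a p.1 p.2 + c a p.2 p.1.
pose B : 'M[R]_(m, size T) := \matrix_(k, b)
  let p := enum_val k in y b 0 p.1 * y b 0 p.2.
have AB : A *m B = (8 : R)%:M.
  apply/matrixP => a b; rewrite !mxE.
  transitivity (dotp (y a - 3^-1 *: x) (y b) * dotp (y a - x) (y b)).
    rewrite /dotp big_distrlr /= sum_pairs_le [RHS]big_enum_val.
    apply: eq_bigr => k _.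
    rewrite !mxE /=; case: eqP => [->|_]; rewrite /c !mxE; ring.
  have [ya5 xa] := T53 _ (yT a); have [yb5 xb] := T53 _ (yT b).
  rewrite !dotp_lin xb; have [<-|ab] := eqVneq a b; first by rewrite ya5 mulr1n; field.
  have /(T13 _ _ (yT a) (yT b)) : y a != y b by rewrite nth_uniq // ltn_ord.
  by rewrite mulr0n; case=> ->; field.
have rk : \rank (A *m B) = size T.
  by rewrite AB; apply/eqP/row_freeP; exists (8^-1)%:M; rewrite -scalar_mxM mulfV ?pnatr_eq0.
rewrite -rk -card_pairs_le; apply: leq_trans (mxrankM_maxl _ _) (rank_leq_col _).
Qed.

(** * Norm 2 vectors with integral products: counting and the bound 240 *)

Definition root_seq (R : realType) n (P : seq 'rV[R]_n) : Prop :=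
  [/\ uniq P, {in P, forall p, dotp p p = 2}
    & {in P &, forall p q, dotp p q \is a Num.int}].

Lemma int_sqr_le4 (R : realType) (a : R) :
  a \is a Num.int -> a ^+ 2 <= 4 -> a \in [:: 2; -2; 1; -1; 0].
Proof.
move=> /intrP[m ->]; rewrite -rmorphXn /= (ler_int _ (m ^+ 2) 4) => m4.
have : m \in [:: 2; -2; 1; -1; 0] by rewrite !inE; nia.
by rewrite !inE => /or4P[/eqP->|/eqP->|/eqP->|/orP[/eqP->|/eqP->]];
  rewrite ?rmorphN /= eqxx ?orbT.
Qed.

Lemma root_dotp (R : realType) n (p q : 'rV[R]_n) :
    dotp p p = 2 -> dotp q q = 2 -> dotp p q \is a Num.int ->
  dotp p q \in [:: 2; -2; 1; -1; 0].
Proof.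
move=> p2 q2 pq; apply: int_sqr_le4 => //; apply: le_trans (dotp_CS p q) _.
by rewrite p2 q2 -natrM.
Qed.

Lemma dotp_eq2 (R : realType) n (p q : 'rV[R]_n) :
  dotp p p = 2 -> dotp q q = 2 -> dotp p q = 2 -> q = p.
Proof.
move=> p2 q2 pq; apply/eqP; rewrite -subr_eq0; apply/eqP/dotp_eq0.
by rewrite !dotp_lin (dotpC q p) p2 q2 pq; ring.
Qed.

Lemma dotp_eqN2 (R : realType) n (p q : 'rV[R]_n) :
  dotp p p = 2 -> dotp q q = 2 -> dotp p q = -2 -> q = - p.
Proof.
move=> p2 q2 pq; apply: dotp_eq2 => //; rewrite ?dotp_lin ?p2 ?pq; ring.
Qed.

Lemma count_dotp2 (R : realType) n (P : seq 'rV[R]_n) (r : 'rV[R]_n) :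
    uniq P -> {in P, forall p, dotp p p = 2} -> dotp r r = 2 ->
  count (fun t => dotp r t == 2) P = (r \in P).
Proof.
move=> uP P2 r2; rewrite -count_uniq_mem //; apply: eq_in_count => t tP /=.
apply/eqP/eqP => [|->//]; exact: dotp_eq2 (P2 _ tP).
Qed.

Lemma count_dotpN2 (R : realType) n (P : seq 'rV[R]_n) (r : 'rV[R]_n) :
    uniq P -> {in P, forall p, dotp p p = 2} -> dotp r r = 2 ->
  count (fun t => dotp r t == -2) P = (- r \in P).
Proof.
move=> uP P2 r2; rewrite -count_uniq_mem //; apply: eq_in_count => t tP /=.
apply/eqP/eqP => [|->]; last by rewrite dotp_lin r2.
exact: dotp_eqN2 (P2 _ tP).
Qed.

(** By Cauchy-Schwarz only the products 2, -2, 1, -1 and 0 occur, so every moment of the products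
    with [r] is determined by five counts. *)
Lemma sum_root_dotp (R : realType) n (f : R -> R) (r : 'rV[R]_n) (P : seq 'rV[R]_n) :
    dotp r r = 2 -> {in P, forall p, dotp p p = 2} ->
    {in P, forall p, dotp r p \is a Num.int} ->
  let c k := (count (fun t => dotp r t == k) P)%:R in
  \sum_(t <- P) f (dotp r t) =
    f 2 * c 2 + f (-2) * c (-2) + f 1 * c 1 + f (-1) * c (-1) + f 0 * c 0.
Proof.
move=> r2; elim: P => [|p P IH] P2 Pr /=; first by rewrite big_nil; ring.
rewrite big_cons {}IH => [|q qP|q qP]; first last.
- by apply: Pr; rewrite inE qP orbT.
- by apply: P2; rewrite inE qP orbT.
have := root_dotp r2 (P2 _ (mem_head _ _)) (Pr _ (mem_head _ _)).
have ne a b : 0 < (a - b) ^+ 2 -> (a == b :> R) = false.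
  by apply: contraTF => /eqP ->; rewrite subrr expr0n ltxx.
rewrite !natrD; set d := dotp r p.
by rewrite !inE => /or4P[/eqP->|/eqP->|/eqP->|/orP[/eqP->|/eqP->]];
  rewrite !eqxx !ne /=; try lra.
Qed.

Lemma root_seq_sub (R : realType) n (P T : seq 'rV[R]_n) :
  uniq T -> {subset T <= P} -> root_seq P -> root_seq T.
Proof.
move=> uT TP [_ P2 PZ]; split=> // [p /TP/P2 //|p q /TP pP /TP qP]; exact: PZ.
Qed.

Lemma size_root_dotp (R : realType) n (r : 'rV[R]_n) (P : seq 'rV[R]_n) :
    dotp r r = 2 -> {in P, forall p, dotp p p = 2} ->
    {in P, forall p, dotp r p \is a Num.int} ->
  let c (k : R) := count (fun t => dotp r t == k) P in
  size P = (c 2%R + c (-2)%R + c 1%R + c (-1)%R + c 0%R)%N.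
Proof.
move=> r2 P2 Pr c; have := sum_root_dotp (fun=> 1) r2 P2 Pr.
have -> : \sum_(t <- P) (fun=> 1) (dotp r t) = (size P)%:R :> R.
  by rewrite -sum1_size natr_sum.
rewrite /= !mul1r -!natrD => /eqP.
by rewrite eqr_nat => /eqP.
Qed.

(* Subtracting r / 2 turns T into vectors of norm 3/2 in the hyperplane
   orthogonal to r spanning at most 28 lines at angle arccos (1/3). *)
Lemma root_neighbours_le (R : realType) (r : 'rV[R]_8) (T : seq 'rV[R]_8) :
    dotp r r = 2 -> root_seq T -> {in T, forall t, dotp r t = 1} ->
  (size T <= 56)%N.
Proof.
(* [h *: r] is the unit vector that forms the frame to be projected away. *)
move=> r2 [uT T2 TZ] rT; pose h : R := Num.sqrt 2^-1.
have hh : h ^+ 2 = 2^-1 by rewrite sqr_sqrtr // invr_ge0.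
pose u (t : 'rV[R]_8) := t - 2^-1 *: r.
have uu t t' : t \in T -> t' \in T -> dotp (u t) (u t') = dotp t t' - 2^-1.
  move=> tT tT'; rewrite !dotp_lin (dotpC t r) (rT _ tT) (rT _ tT') r2.
  by field.
have := @frame_bound R 8 1 (h *: r) (map u T) isT.
rewrite [(h *: r)^T]linearZ /= -scalemxAl -scalemxAr scalerA -expr2 hh.
have E1 : 2^-1 *: (r *m r^T) = 1%:M :> 'M[R]_1.
  apply/matrixP => i j; rewrite !ord1 mxE -dotpE r2 mxE /=.
  by field.
have E0 : {in map u T, forall x, x *m (h *: r^T) = 0}.
  move=> x /mapP[v vT ->]; apply/matrixP => i j.
  rewrite !ord1 -scalemxAr mxE -dotpE !dotp_lin (dotpC v r) (rT _ vT) r2 mxE.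
  by field.
move=> /(_ E1 E0); rewrite !big_map.
have -> : \sum_(t <- T) dotp (u t) (u t) = 3 / 2 * (size T)%:R.
  rewrite -sum1_size natr_sum mulr_sumr [LHS]big_seq [RHS]big_seq.
  by apply: eq_bigr => t tT; rewrite uu // T2 //; field.
(* A product a contributes (a - 1/2)^2, which is 1/4 for a = 0 or 1 and 9/4 for a = 2 or -1. The
   value 2 occurs for [t] alone and -1 at most once, hence N/4 + 2 + 2. *)
have S t : t \in T ->
    \sum_(t' <- map u T) dotp (u t) t' ^+ 2 <= (size T)%:R / 4 + 4.
  move=> tT; rewrite big_map.
  rewrite (eq_big_seq (fun t' => (dotp t t' - 2^-1) ^+ 2)); last first.
    by move=> t' tT' /=; rewrite uu.
  have t2 := T2 _ tT.
  have tZ : {in T, forall t', dotp t t' \is a Num.int}.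
    by move=> t' tT'; apply: TZ.
  rewrite (sum_root_dotp (fun a => (a - 2^-1) ^+ 2) t2 T2 tZ).
  rewrite (size_root_dotp t2 T2 tZ) count_dotp2 // count_dotpN2 // tT.
  have -> : - t \in T = false.
    by apply/negP => /rT; rewrite dotp_lin (rT _ tT); lra.
  have c1 : (count (fun t' => dotp t t' == (-1)%R) T <= 1)%N.
    apply: leq_trans (leq_b1 (r - t \in T)); rewrite -count_uniq_mem // leq_eqVlt.
    apply/orP/or_introl/eqP/eq_in_count => t' tT' /=.
    apply/eqP/eqP => [tt'|->]; last by rewrite !dotp_lin t2 (dotpC t r) (rT _ tT); ring.
    (* If (t, t') = -1 then t + t' has norm 2 and product 2 with r, so it is r. *)
    have <- : t + t' = r; last by rewrite addrAC subrr add0r.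
    apply: dotp_eq2 => //; last by rewrite dotp_lin !rT.
    by rewrite !dotp_lin (dotpC t') tt' t2 T2 //; ring.
  move: c1; rewrite -(ler_nat R) !natrD /=; lra.
have {}S : \sum_(t <- T) \sum_(t' <- map u T) dotp (u t) t' ^+ 2 <=
    (size T)%:R * ((size T)%:R / 4 + 4).
  rewrite -[X in X%:R * _]sum1_size natr_sum mulr_suml [leLHS]big_seq [leRHS]big_seq.
  by apply: ler_sum => t tT; rewrite mul1r S.
(* Here (3N/2)^2 <= 7 N (N/4 + 4), which gives N <= 56. *)
rewrite (_ : 8 - 1 = 7)%N // -(ler_nat R); move: S.
set N := (size T)%:R; set A := \sum_(t <- T) _ => SA SN.
rewrite leNgt; apply/negP => N56; nra.
Qed.

Lemma count_neighbours_le (R : realType) (r : 'rV[R]_8) (P : seq 'rV[R]_8) :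
  root_seq P -> dotp r r = 2 -> (count (fun t => dotp r t == 1%R) P <= 56)%N.
Proof.
move=> rP r2; rewrite -size_filter; apply: (root_neighbours_le r2) => [|t].
  have [uP _ _] := rP; apply: root_seq_sub (filter_uniq _ uP) _ rP.
  exact: mem_subseq (filter_subseq _ _).
by rewrite mem_filter => /andP[/eqP].
Qed.

Lemma count_neighboursN_le (R : realType) (r : 'rV[R]_8) (P : seq 'rV[R]_8) :
  root_seq P -> dotp r r = 2 -> (count (fun t => dotp r t == (-1)%R) P <= 56)%N.
Proof.
move=> rP r2; have r2N : dotp (- r) (- r) = 2 by rewrite !dotp_lin opprK.
rewrite -(eq_count (a1 := fun t => dotp (- r) t == 1)); last first.
  by move=> t; rewrite dotpNl eqr_oppLR.
exact: count_neighbours_le.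
Qed.

Lemma root_counts (R : realType) (r : 'rV[R]_8) (P : seq 'rV[R]_8) :
    root_seq P -> r \in P ->
  let c (k : R) := count (fun t => dotp r t == k) P in
  size P = (1 + (- r \in P) + c 1%R + c (-1)%R + c 0%R)%N /\
  \sum_(t <- P) dotp r t ^+ 2 =
    4 + 4 * (- r \in P)%:R + (c 1)%:R + (c (-1))%:R.
Proof.
move=> [uP P2 PZ] rP c; have r2 := P2 _ rP.
have rZ : {in P, forall p, dotp r p \is a Num.int} by move=> p; apply: PZ.
rewrite (size_root_dotp r2 P2 rZ) (sum_root_dotp (fun a => a ^+ 2) r2 P2 rZ).
rewrite count_dotp2 // count_dotpN2 // rP; split=> //.
by rewrite /c /=; ring.
Qed.

(** Each row sum is at most 4 + 4 + 56 + 56 = 120, so the second moment bound gives (2N)^2 <= 8 *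
    120 N. For N = 240 this is an equality and no row sum can fall short. *)
Lemma root_seq_le (R : realType) (P : seq 'rV[R]_8) :
  root_seq P -> (size P <= 240)%N /\
  (size P = 240%N -> {in P, forall r, \sum_(t <- P) dotp r t ^+ 2 = 120}).
Proof.
move=> rP; have [uP P2 PZ] := rP.
have S r : r \in P -> \sum_(t <- P) dotp r t ^+ 2 <= 120.
  move=> rP'; have [_ ->] := root_counts rP rP'.
  have := count_neighbours_le rP (P2 _ rP').
  have := count_neighboursN_le rP (P2 _ rP').
  rewrite -2!(ler_nat R); case: (_ \in _) => /=; lra.
have := frame_bound_full P2.
have -> : \sum_(x <- P) \sum_(y <- P) dotp x y ^+ 2 =
    120 * (size P)%:R - \sum_(x <- P) (120 - \sum_(y <- P) dotp x y ^+ 2).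
  rewrite sumrB -sum1_size natr_sum mulr_sumr opprB addrC.
  by under [X in _ - _ + X]eq_bigr do rewrite mulr1; rewrite subrK.
have S0 : 0 <= \sum_(x <- P) (120 - \sum_(y <- P) dotp x y ^+ 2).
  by rewrite big_seq sumr_ge0 // => x xP; rewrite subr_ge0 S.
move: S0; set D := \sum_(x <- P) (_ - _); set N := (size P)%:R => S0 SN.
split=> [|P240 r rP'].
  by rewrite -(ler_nat R) leNgt; apply/negP => N240; rewrite -/N in N240; nra.
have D0 : D == 0 by move: SN; rewrite /N P240; lra.
move: D0; rewrite /D big_seq psumr_eq0 => [/allP D0|x xP]; last first.
  by rewrite subr_ge0 S.
by have := D0 _ rP'; rewrite rP' subr_eq0 => /eqP <-.
Qed.

(** * Systems of 240 roots *)

(** A row sum of 120 requires 112 or 116 roots of product 1 or -1, according as [- r] is in [P] or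
    not, and at most 56 + 56 are possible. The remaining 240 - 2 - 112 = 126 roots are orthogonal to
    [r]. *)
Lemma root_seq240 (R : realType) (r : 'rV[R]_8) (P : seq 'rV[R]_8) :
    root_seq P -> size P = 240%N -> r \in P ->
  let c (k : R) := count (fun t => dotp r t == k) P in
  [/\ - r \in P, c 1%R = 56%N, c (-1)%R = 56%N & c 0%R = 126%N].
Proof.
move=> rP P240 rP' c; have [_ P2 _] := rP; have r2 := P2 _ rP'.
have [] := root_counts rP rP'; rewrite (root_seq_le rP).2 // P240 -!/(c _).
have := count_neighbours_le rP r2; have := count_neighboursN_le rP r2.
rewrite -!/(c _); case: (_ \in _) => h1 h2 /= s1 sR.
  have : (c 1%R + c (-1)%R)%:R == 112%:R :> R by rewrite natrD; move: sR; clear; lra.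
  by rewrite eqr_nat => /eqP s2; split=> //; lia.
have : (c 1%R + c (-1)%R)%:R == 116%:R :> R by rewrite natrD; move: sR; clear; lra.
rewrite eqr_nat => /eqP; lia.
Qed.

(* Otherwise v :: P would be a root sequence of size 241. *)
Lemma root_seq240_max (R : realType) (v : 'rV[R]_8) (P : seq 'rV[R]_8) :
    root_seq P -> size P = 240%N -> dotp v v = 2 ->
  {in P, forall p, dotp v p \is a Num.int} -> v \in P.
Proof.
move=> [uP P2 PZ] P240 v2 vP; apply/negPn/negP => vnP.
suff /root_seq_le[] : root_seq (v :: P) by rewrite /= P240.
split=> [|p|p q]; first by rewrite /= vnP.
  by rewrite inE => /predU1P[->//|/P2].
rewrite !inE => /predU1P[->|pP] /predU1P[->|qP].
- by rewrite v2 natr_int.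
- exact: vP.
- by rewrite dotpC; apply: vP.
- exact: PZ.
Qed.

(* s |-> t - s exchanges the roots of products 0 and 1 with r among the 56
   neighbours of t, and only r and t - r have other products. *)
Lemma root_common_ge (R : realType) (r t : 'rV[R]_8) (P : seq 'rV[R]_8) :
    root_seq P -> size P = 240%N -> r \in P -> t \in P -> dotp r t = 1 ->
  (27 <= count (fun s => (dotp r s == 0%R) && (dotp t s == 1%R)) P)%N.
Proof.
move=> rP P240 Pr Pt rt; have [uP P2 PZ] := rP.
pose T := [seq s <- P | dotp t s == 1].
have Tt s : s \in T -> dotp t s = 1 /\ s \in P.
  by rewrite mem_filter => /andP[/eqP].
have uT : uniq T by rewrite filter_uniq.
have T2 : {in T, forall s, dotp s s = 2} by move=> s /Tt[_ /P2].
have TZ : {in T, forall s, dotp r s \is a Num.int} by move=> s /Tt[_ Ps]; apply: PZ.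
have sT : size T = 56%N.
  by rewrite size_filter; have [_ ->] := root_seq240 rP P240 Pt.
have /= := size_root_dotp (P2 _ Pr) T2 TZ.
rewrite sT (count_dotp2 uT T2 (P2 _ Pr)) (count_dotpN2 uT T2 (P2 _ Pr)).
have -> : - r \in T = false.
  by apply/negP => /Tt[]; rewrite dotpNr dotpC rt; lra.
rewrite -(count_filter (fun s => dotp r s == 0)) -/T.
have cN1 : (count (fun s => dotp r s == (-1)%R) T <= 1)%N.
  apply: leq_trans (leq_b1 (t - r \in T)); rewrite -count_uniq_mem // leq_eqVlt.
  apply/orP/or_introl/eqP/eq_in_count => s /[dup] sT' /Tt[ts Ps] /=.
  apply/eqP/eqP => [rs|->]; last by rewrite !dotp_lin P2 // rt; ring.
  have <- : r + s = t; last by rewrite addrAC subrr add0r.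
  apply: dotp_eq2; [exact: P2 | | by rewrite dotp_lin ts dotpC rt].
  by rewrite !dotp_lin (dotpC s) rs !P2 //; ring.
have c10 : (count (fun s => dotp r s == 1%R) T <= count (fun s => dotp r s == 0%R) T)%N.
  rewrite -!size_filter -(size_map (fun s => t - s)); apply: uniq_leq_size.
    by rewrite map_inj_uniq ?filter_uniq // => a b /addrI/oppr_inj.
  move=> _ /mapP[s + ->]; rewrite mem_filter => /andP[/eqP rs /Tt[ts Ps]].
  rewrite mem_filter dotp_lin rt dotpNr rs subrr eqxx /=.
  have tt : dotp t (t - s) = 1 by rewrite !dotp_lin P2 // ts; ring.
  rewrite mem_filter tt eqxx /=; apply: (root_seq240_max rP) => // [|p pP].
    by rewrite !dotp_lin (dotpC s) ts !P2 //; ring.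
  by rewrite !dotp_lin rpredB ?PZ.
(* In all 56 <= 1 + 1 + 2c, where c counts the members of [T] orthogonal to [r]. *)
move: cN1 c10; case: (r \in T) => /=; lia.
Qed.

(* Average over the 126 roots s orthogonal to r: 56 * 27 = 126 * 12. *)
Lemma root_orth_pair (R : realType) (r : 'rV[R]_8) (P : seq 'rV[R]_8) :
    root_seq P -> size P = 240%N -> r \in P ->
  exists s, [/\ s \in P, dotp r s = 0
    & (12 <= count (fun t => (dotp r t == 1%R) && (dotp s t == 1%R)) P)%N].
Proof.
move=> rP P240 Pr; have [_ c1 _ c0] := root_seq240 rP P240 Pr.
pose m s := count (fun t => (dotp r t == 1) && (dotp s t == 1)) P.
suff /hasP[s sP /andP[/eqP rs s12]] :
    has (fun s => (dotp r s == 0) && (12 <= m s)%N) P by exists s.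
apply/negPn/negP; rewrite -all_predC => /allP m11.
have le11 : (\sum_(s <- P | dotp r s == 0%R) m s <= 126 * 11)%N.
  rewrite -c0 -sum1_count big_distrl /= big_seq_cond [leqRHS]big_seq_cond.
  apply: leq_sum => s /andP[sP rs].
  by have /= := m11 _ sP; rewrite rs -ltnNge.
have : (56 * 27 <= \sum_(s <- P | dotp r s == 0%R) m s)%N; last first.
  by move=> le12; have := leq_trans le12 le11.
under eq_bigr do rewrite /m -sum1_count.
rewrite (exchange_big_dep (fun t => dotp r t == 1)) /=; last by move=> s t _ /andP[].
rewrite -c1 -sum1_count big_distrl /= big_seq_cond [leqRHS]big_seq_cond.
apply: leq_sum => t /andP[tP rt]; rewrite mul1n sum1_count.
apply: leq_trans (root_common_ge rP P240 Pr tP (eqP rt)) _.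
by apply: sub_count => s /=; rewrite rt (dotpC s).
Qed.

(** * The orthogonal frame *)

(** Greedy choice: taking x discards at most x and - x, so k choices need only 2k - 1 vectors. *)
Lemma orth_subseq (R : realType) n k (s : seq 'rV[R]_n) :
    uniq s -> (k.*2 <= (size s).+1)%N ->
    {in s &, forall x y, x != y -> y = - x \/ dotp x y = 0} ->
  exists s', [/\ size s' = k, {subset s' <= s}
    & pairwise (fun x y => dotp x y == 0) s'].
Proof.
elim: k s => [|k IH] s; first by exists [::].
case: s => [|x s]; first by rewrite doubleS.
move=> /= /andP[xs us]; rewrite doubleS !ltnS => ks sO.
have us' := rem_uniq (- x) us.
have ks' : (k.*2 <= (size (rem (- x) s)).+1)%N.
  have [xin|xnin] := boolP (- x \in s); last by rewrite rem_id // ltnW.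
  by rewrite size_rem //; case: (s) xin ks => //=.
have sub : {subset rem (- x) s <= s} by apply: mem_rem.
have [|s' [ss' s's s'O]] := IH _ us' ks'.
  by move=> a b /sub as_ /sub bs; apply: sO; rewrite inE ?as_ ?bs orbT.
exists (x :: s'); rewrite /= ss' s'O andbT; split=> // [y|].
  by rewrite !inE => /predU1P[->|/s's/sub ->]; rewrite ?eqxx ?orbT.
apply/allP => y /s's; rewrite mem_rem_uniq // !inE => /andP[yx ys].
apply/eqP; case: (sO x y) => //; rewrite ?inE ?eqxx ?ys ?orbT //.
  by apply: contraNneq xs => ->.
by move=> yE; rewrite yE eqxx in yx.
Qed.

(* The frame consists of the norm 4 vectors congruent to v = r + s modulo twice
   the root lattice: v itself and the v - 2 t, for the roots t with (v, t) = 2. *)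
Lemma root_frame (R : realType) (P : seq 'rV[R]_8) :
    root_seq P -> size P = 240%N ->
  exists2 Q : 'M[R]_8, orthogonal_mx Q &
    {in P, forall p, 2 * (p *m Q) 0 0 \is a Num.int /\
      forall i, (p *m Q) 0 i - (p *m Q) 0 0 \is a Num.int}.
Proof.
move=> rP P240; have [uP P2 PZ] := rP.
have [r Pr] : exists r, r \in P.
  by case: (P) P240 => // r ? _; exists r; rewrite mem_head.
have [s [Ps rs s12]] := root_orth_pair rP P240 Pr.
(* [L] has at least 2 + 12 = 14 members, all of product 2 with r + s. *)
pose L := [:: r, s & [seq t <- P | (dotp r t == 1) && (dotp s t == 1)]].
pose v := r + s.
have v4 : dotp v v = 4 by rewrite !dotp_lin (dotpC s) rs !P2 //; ring.
have LP t : t \in L -> t \in P /\ dotp v t = 2.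
  rewrite /v !inE dotpDl mem_filter => /or3P[/eqP->|/eqP->|].
  - by rewrite P2 // (dotpC s) rs addr0.
  - by rewrite P2 // rs add0r.
  - by move=> /andP[/andP[/eqP-> /eqP->]].
have vZ : {in P, forall p, dotp p v \is a Num.int}.
  by move=> p pP; rewrite dotpDr rpredD ?PZ.
clearbody v.
have uL : uniq L.
  rewrite /= inE !mem_filter filter_uniq // (dotpC s) rs P2 // !negb_or !negb_and.
  rewrite (_ : 2 == 1 = false) ?orbT ?andbT /=; last exact: (eqr_nat R 2 1).
  rewrite (_ : 0 == 1 = false) ?orbT ?andbT /=; last by rewrite eq_sym oner_eq0.
  by apply: contra_eq_neq rs => ->; rewrite P2 // pnatr_eq0.
pose w (t : 'rV[R]_8) := v - 2 *: t.
have uW : uniq (map w L).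
  rewrite map_inj_uniq // => a b /addrI/oppr_inj/scalerI; apply.
  by rewrite pnatr_eq0.
have ww a b : a \in L -> b \in L -> dotp (w a) (w b) = 4 * dotp a b - 4.
  move=> /LP[_ va] /LP[_ vb]; rewrite /w !dotp_lin v4 (dotpC a v) va vb; ring.
(* The vectors [w a] and [w b] are orthogonal if (a, b) = 1 and opposite if (a, b) = 0; (a, b) = -1
   or -2 would give norm 4 vectors with product -8 or -12. *)
have W2 : {in map w L &, forall x y, x != y -> y = - x \/ dotp x y = 0}.
  move=> _ _ /mapP[a aL ->] /mapP[b bL ->] wab.
  have [aP va] := LP _ aL; have [bP vb] := LP _ bL.
  have w4 c : c \in L -> dotp (w c) (w c) = 4.
    by move=> cL; rewrite ww // P2 ?(LP _ cL).1 //; ring.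
  have wS := dotp_ge0 (w a + w b); rewrite dotp_sqrD !w4 // ww // in wS.
  have := root_dotp (P2 _ aP) (P2 _ bP) (PZ _ _ aP bP).
  rewrite !inE => /or4P[/eqP ab|/eqP ab|/eqP ab|/orP[/eqP ab|/eqP ab]].
  - by rewrite (dotp_eq2 (P2 _ aP) (P2 _ bP) ab) eqxx in wab.
  - by exfalso; move: wS ab; clear; lra.
  - by right; rewrite ww // ab; ring.
  - by exfalso; move: wS ab; clear; lra.
  - left; apply/eqP; rewrite -addr_eq0 addrC; apply/eqP/dotp_eq0.
    by rewrite dotp_sqrD !w4 // ww // ab; ring.
have W14 : (7.*2 <= (size (map w L)).+1)%N.
  by rewrite size_map /= size_filter; move: s12; lia.
have [g [g7 gW gO]] := orth_subseq uW W14 W2.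
have g4 x : x \in v :: g -> dotp x x = 4.
  rewrite inE => /predU1P[->//|/gW /mapP[a aL ->]].
  by rewrite ww // P2 ?(LP _ aL).1 //; ring.
have {}gO : pairwise (fun x y => dotp x y == 0) (v :: g).
  rewrite /= gO andbT; apply/allP => _ /gW /mapP[a /LP[_ va] ->].
  by rewrite !dotp_lin v4 va; apply/eqP; ring.
pose B : 'M[R]_8 := \matrix_i (2^-1 *: (v :: g)`_i).
have gi (i : 'I_8) : (i < size (v :: g))%N by rewrite /= g7.
have BB : B *m B^T = 1%:M.
  apply/matrixP => i j.
  transitivity (2^-1 * (2^-1 * dotp (v :: g)`_i (v :: g)`_j)).
    rewrite -dotpZl -dotpZr mxE; apply: eq_bigr => k _.
    by rewrite !mxE.
  rewrite mxE; have [->|] := eqVneq i j; first by rewrite g4 ?mem_nth //=; field.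
  have O (a b : 'I_8) : (a < b)%N -> dotp (v :: g)`_a (v :: g)`_b = 0.
    by move=> ab; apply/eqP; move/(pairwiseP 0): gO; apply; rewrite ?inE.
  rewrite neq_ltn => /orP[/O ->|/O]; first by rewrite !mulr0.
  by rewrite dotpC => ->; rewrite !mulr0.
exists B^T; first by rewrite /orthogonal_mx trmxK; apply: mulmx1C.
move=> p pP.
have pB i : (p *m B^T) 0 i = 2^-1 * dotp p (v :: g)`_i.
  by rewrite -dotpZr mxE; apply: eq_bigr => k _; rewrite !mxE.
(* The coordinate of p at a frame vector g is (p, g) / 2; for g = v - 2t it differs from (p, v) / 2
   by the integer (p, t). *)
rewrite pB mulrA mulfV ?pnatr_eq0 // mul1r vZ //; split=> // i.
have : (v :: g)`_i \in v :: g by rewrite mem_nth.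
rewrite !pB inE => /predU1P[->|/gW /mapP[t /LP[tP _] ->]].
  by rewrite subrr rpred0.
rewrite /w !dotp_lin; rewrite -[X in X \is a _](_ : - dotp p t = _) ?rpredN ?PZ //.
by field.
Qed.

(** * Integral spans and coordinates of the E8 lattice *)

Lemma int_span_sum (V : zmodType) (G : set V) m (f : 'I_m -> V) (a : 'I_m -> int) :
  (forall i, G (f i)) -> int_span G (\sum_i f i *~ a i).
Proof.
move=> Gf; exists m, [tuple f i | i < m]; split=> [i|]; first by rewrite tnth_mktuple.
exists (finfun a); apply: eq_bigr => i _.
by rewrite ffunE -tnth_nth tnth_mktuple.
Qed.

Lemma int_span_dotp (R : realType) n (G : set 'rV[R]_n) (c v : 'rV[R]_n) :
    (forall g, G g -> dotp g c \is a Num.int) -> int_span G v ->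
  dotp v c \is a Num.int.
Proof.
move=> Gc [m [s [Gs [a ->]]]].
rewrite dotpE mulmx_suml summxE rpred_sum // => i _.
rewrite -scaler_int -dotpE dotpZl rpredM ?intr_int // -tnth_nth.
exact: Gc.
Qed.

Lemma half_int_cases (R : realType) (a : R) :
  2 * a \is a Num.int -> a \is a Num.int \/ a - 2^-1 \is a Num.int.
Proof.
move=> /intrP[m am].
have [k [mk|mk]] : exists k : int, m = 2 * k \/ m = 2 * k + 1.
  by exists (m %/ 2)%Z; lia.
- left; apply/intrP; exists k; move: am; rewrite mk rmorphM /=; lra.
- right; apply/intrP; exists k; move: am; rewrite mk rmorphD rmorphM /=; lra.
Qed.

(** The usual coordinate description of E8: all coordinates in Z or all in 1/2 + Z, with even
    sum. *)
Definition E8_coord (R : realType) (c : 'rV[R]_8) : Prop :=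
  [/\ 2 * c 0 0 \is a Num.int, forall i, c 0 i - c 0 0 \is a Num.int
    & (\sum_i c 0 i) / 2 \is a Num.int].

(** The conditions on [c] make its products with the generators of E8 integral, and integrality
    passes to integer combinations. *)
Lemma E8_coord_dotp (R : realType) (v c : 'rV[R]_8) :
  lattice_E8 R v -> E8_coord c -> dotp v c \is a Num.int.
Proof.
move=> Ev [c0 ci cS]; have ee i : dotp (std_basis R i) c = c 0 i.
  rewrite /dotp (bigD1 i) //= big1 => [|j ji]; rewrite !mxE ?eqxx /=.
    by rewrite mul1r addr0.
  by rewrite (negbTE ji) mul0r.
apply: int_span_dotp Ev => g [Dg|->]; last first.
  rewrite dotpZl (_ : dotp (const_mx 1) c = \sum_i c 0 i) 1?mulrC //.
  by apply: eq_bigr => i _; rewrite mxE mul1r.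
apply: int_span_dotp Dg => h [i [j [->|->]]]; rewrite !dotp_lin !ee.
- have -> : c 0 i + c 0 j = (c 0 i - c 0 0) + (c 0 j - c 0 0) + 2 * c 0 0 by ring.
  by apply: rpredD c0; apply: rpredD; apply: ci.
- have -> : c 0 i - c 0 j = (c 0 i - c 0 0) - (c 0 j - c 0 0) by ring.
  by apply: rpredB; apply: ci.
Qed.

(** If the sum is 2k, then c = k (2 e_0) + the sum over i > 0 of c_i (e_i - e_0), where 2 e_0 = e_0
    + e_0 is itself a generator. *)
Lemma D8_mem (R : realType) (c : 'rV[R]_8) :
    (forall i, c 0 i \is a Num.int) -> (\sum_i c 0 i) / 2 \is a Num.int ->
  lattice_D8 R c.
Proof.
move=> cZ /intrP[k ck].
pose f (i : 'I_8) := if i == 0 then std_basis R 0 + std_basis R 0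
                     else std_basis R i - std_basis R 0.
pose a i := if i == 0 then k else Num.floor (c 0 i).
have -> : c = \sum_i f i *~ a i.
  have cE i : c 0 i = (Num.floor (c 0 i))%:~R by rewrite floorK.
  have k2 : k%:~R * 2 = c 0 0 + \sum_(i < 7) c 0 (lift ord0 i).
    by rewrite -big_ord_recl -ck; field.
  rewrite [LHS]row_sum_delta [LHS]big_ord_recl [RHS]big_ord_recl /f /a /=.
  rewrite [X in _ = _ + X](_ : _ = \sum_(i < 7) c 0 (lift ord0 i) *: std_basis R (lift ord0 i)
      - (\sum_(i < 7) c 0 (lift ord0 i)) *: std_basis R 0); last first.
    rewrite scaler_suml -sumrB; apply: eq_bigr => i _.
    by rewrite -scaler_int -cE scalerBr.
  rewrite -scaler_int -mulr2n -scaler_nat scalerA k2 scalerDl.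
  by rewrite addrACA subrr addr0.
apply: int_span_sum => i; rewrite /f; case: eqP => _.
  by exists 0, 0; left.
by exists i, 0; right.
Qed.

(** Subtracting half the all-one vector when the coordinates are half-integral makes them integral
    and changes the sum by 4, so the difference lies in D8. *)
Lemma E8_coord_mem (R : realType) (c : 'rV[R]_8) : E8_coord c -> lattice_E8 R c.
Proof.
move=> [c0 ci cS].
have [b bZ] : exists b : bool, c 0 0 - b%:R / 2 \is a Num.int.
  have [?|?] := half_int_cases c0; first by exists false; rewrite mul0r subr0.
  by exists true; rewrite mul1r.
pose d : 'rV[R]_8 := c - b%:R *: (2^-1 *: const_mx 1).
have di i : d 0 i = c 0 i - b%:R / 2 by rewrite !mxE mulr1.
have Dd : lattice_D8 R d.
  apply: D8_mem => [i|].
    rewrite di; have -> : c 0 i - b%:R / 2 = c 0 i - c 0 0 + (c 0 0 - b%:R / 2) by ring.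
    exact: rpredD.
  under eq_bigr do rewrite di.
  rewrite sumrB big_const_ord iter_addr_0 mulrBl.
  rewrite (_ : _ *+ 8 / 2 = 2 * b%:R); last by field.
  by rewrite rpredB // rpredM ?natr_int.
pose f (i : 'I_2) := if i == 0 then d else 2^-1 *: const_mx 1.
pose a (i : 'I_2) : int := if i == 0 then 1 else b%:R.
have -> : c = \sum_i f i *~ a i.
  rewrite big_ord_recl big_ord1 /f /a /= mulr1z /d.
  by case: (b); rewrite ?scale1r ?scale0r ?mulr1z ?mulr0z ?subrK ?subr0 ?addr0.
apply: int_span_sum => i; rewrite /f; case: eqP => _; [left|right]; by [].
Qed.

(** Since m^2 - m is even, the coordinate sum has the parity of the norm. *)
Lemma sum_even (R : realType) n (d : 'rV[R]_n) :
    (forall i, d 0 i \is a Num.int) -> dotp d d / 2 \is a Num.int ->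
  (\sum_i d 0 i) / 2 \is a Num.int.
Proof.
move=> dZ dd.
have -> : (\sum_i d 0 i) / 2 = dotp d d / 2 - \sum_i (d 0 i * d 0 i - d 0 i) / 2.
  by rewrite -mulr_suml sumrB -/(dotp d d); field.
rewrite rpredB // rpred_sum // => i _.
have /intrP[m ->] := dZ i.
have [k mk] : exists k : int, m * m - m = 2 * k.
  have [k [->|->]] : exists k : int, m = 2 * k \/ m = 2 * k + 1.
    by exists (m %/ 2)%Z; lia.
  - by exists (k * (2 * k - 1)); ring.
  - by exists (k * (2 * k + 1)); ring.
rewrite -rmorphM -rmorphB /= mk rmorphM /= mulrAC mulfV ?pnatr_eq0 // mul1r.
exact: intr_int.
Qed.

(* The parity of the sum of the coordinates is the same for all the p with
   half-integral coordinates; changing the sign of one coordinate makes it even. *)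
Lemma root_frame_E8 (R : realType) (P : seq 'rV[R]_8) :
    root_seq P -> size P = 240%N ->
  exists2 Q : 'M[R]_8, orthogonal_mx Q & {in P, forall p, E8_coord (p *m Q)}.
Proof.
move=> rP P240; have [_ P2 PZ] := rP; have [Q QQ hQ] := root_frame rP P240.
have QZ p : p \in P -> (p *m Q) 0 0 \is a Num.int ->
    (\sum_i (p *m Q) 0 i) / 2 \is a Num.int.
  move=> pP p0; apply: sum_even => [i|].
    by rewrite -[_ 0 i](subrK ((p *m Q) 0 0)); apply: rpredD => //; apply: (hQ p pP).2.
  by rewrite dotp_mul_orth // P2 // mulfV ?pnatr_eq0 // rpred1.
have [allE|] := pselect {in P, forall p, (\sum_i (p *m Q) 0 i) / 2 \is a Num.int}.
  by exists Q => // p pP; have [p0 pi] := hQ p pP; split=> //; apply: allE.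
(* Some [q] has a sum that is not even; its coordinates are half-integral, as integral vectors of
   norm 2 have even sum. *)
move=> /existsNP[q /not_implyP[qP /negP qodd]].
have q0 : (q *m Q) 0 0 - 2^-1 \is a Num.int.
  have [q0 _] := hQ q qP; have [/(QZ q qP)|//] := half_int_cases q0.
  by rewrite (negbTE qodd).
pose S (p : 'rV[R]_8) := \sum_i (p *m Q) 0 i.
have Sq : S q / 2 - 2^-1 \is a Num.int.
  have [|Sq|//] := @half_int_cases _ (S q / 2); last by rewrite Sq in qodd.
  rewrite mulrC divfK ?pnatr_eq0 //.
  have -> : S q = \sum_i ((q *m Q) 0 i - (q *m Q) 0 0) + 4 * (2 * (q *m Q) 0 0).
    by rewrite sumrB sumr_const card_ord -/(S q); ring.
  have [q0' qi] := hQ q qP; apply: rpredD.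
    by apply: rpred_sum.
  by rewrite rpredM ?natr_int.
pose d : 'rV[R]_8 := \row_j (-1) ^+ (j == 0).
have dd : diag_mx d *m (diag_mx d)^T = 1%:M.
  rewrite tr_diag_mx mul_diag_mx; apply/matrixP => i j; rewrite !mxE.
  by have [->|_] := eqVneq i j; rewrite ?mulr0 // !mulr1n -signr_addb addbb.
exists (Q *m diag_mx d).
  by rewrite /orthogonal_mx trmx_mul mulmxA -(mulmxA Q) dd mulmx1.
move=> p pP; have [p0 pi] := hQ p pP.
have c0 : (p *m (Q *m diag_mx d)) 0 0 = - (p *m Q) 0 0.
  by rewrite mulmxA mul_mx_diag !mxE eqxx expr1 mulrN1.
have ci i : i != 0 -> (p *m (Q *m diag_mx d)) 0 i = (p *m Q) 0 i.
  by move=> i0; rewrite mulmxA mul_mx_diag !mxE (negbTE i0) expr0 mulr1.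
split=> [|i|]; first by rewrite c0 mulrN rpredN.
  have [->|i0] := eqVneq i 0; first by rewrite subrr rpred0.
  rewrite ci // c0 opprK.
  have -> : (p *m Q) 0 i + (p *m Q) 0 0 =
    (p *m Q) 0 i - (p *m Q) 0 0 + 2 * (p *m Q) 0 0 by ring.
  exact: rpredD.
have -> : (\sum_i (p *m (Q *m diag_mx d)) 0 i) / 2 = S p / 2 - (p *m Q) 0 0.
  rewrite /S (bigD1 0) //= [in RHS](bigD1 0) //= c0.
  by rewrite (eq_bigr _ ci); field.
have [pZ|pH] := half_int_cases p0; first by apply: rpredB => //; apply: QZ.
have pqi i : ((p - q) *m Q) 0 i = (p *m Q) 0 i - (q *m Q) 0 i.
  by rewrite mulmxBl mxE [X in _ + X]mxE.
(* p - q has integral coordinates and even norm 4 - 2 (p, q), hence even sum; this carries the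
   parity from q to p. *)
have Spq : S (p - q) / 2 \is a Num.int.
  apply: sum_even => [i|]; last first.
    rewrite dotp_mul_orth // !dotp_lin (dotpC q) !P2 //.
    rewrite [_ / 2](_ : _ = 2 - dotp p q); last by field.
    by apply: rpredB; [rewrite natr_int | apply: PZ].
  rewrite pqi; have [_ qi] := hQ q qP.
  have -> : (p *m Q) 0 i - (q *m Q) 0 i = ((p *m Q) 0 i - (p *m Q) 0 0)
      - ((q *m Q) 0 i - (q *m Q) 0 0) + (((p *m Q) 0 0 - 2^-1) - ((q *m Q) 0 0 - 2^-1)).
    by ring.
  by apply: rpredD; apply: rpredB.
have -> : S p / 2 - (p *m Q) 0 0 =
    S (p - q) / 2 + (S q / 2 - 2^-1) - ((p *m Q) 0 0 - 2^-1).
  have -> : S (p - q) = S p - S q.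
    by rewrite -sumrB; apply: eq_bigr => i _; rewrite pqi.
  by ring.
by apply: rpredB => //; apply: rpredD.
Qed.

(** The converse inclusion is maximality: a root of E8, pulled back by [Q], has integral products
    with all of [P]. *)
Lemma root_seq240_E8 (R : realType) (P : seq 'rV[R]_8) :
    root_seq P -> size P = 240%N ->
  exists2 Q : 'M[R]_8, orthogonal_mx Q &
    forall p, p \in P <-> lattice_roots (lattice_E8 R) (p *m Q).
Proof.
move=> rP P240; have [_ P2 PZ] := rP; have [Q QQ PQ] := root_frame_E8 rP P240.
exists Q => // p; split=> [pP|[Ep]].
  by split; [exact/E8_coord_mem/PQ | rewrite dotp_mul_orth ?P2].
rewrite dotp_mul_orth // => p2; apply: (root_seq240_max rP) => // q qP.
by rewrite -(dotp_mul_orth p q QQ); apply: E8_coord_dotp Ep (PQ _ qP).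
Qed.

(** * Norm 5 vectors with products 1, -1, 3 and -3 *)

Definition odd_seq (R : realType) (Y : seq 'rV[R]_9) : Prop :=
  [/\ uniq Y, {in Y, forall y, dotp y y = 5}
    & {in Y &, forall y z, y != z -> dotp y z \in [:: 1; -1; 3; -3]}].

(** Oddness of a is expressed as integrality of (a + 1) / 2, a form convenient for combinations a +
    b - c. *)
Lemma odd_int (R : realType) (a : R) :
  a \in [:: 1; -1; 3; -3; 5; -5] -> (a + 1) / 2 \is a Num.int.
Proof.
move=> aE; suff [m ->] : exists m : int, (a + 1) / 2 = m%:~R by apply: intr_int.
move: aE; rewrite !inE => /or4P[/eqP->|/eqP->|/eqP->|/or3P[/eqP->|/eqP->|/eqP->]].
- by exists 1; field.
- by exists 0; field.
- by exists 2; field.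
- by exists (-1); field.
- by exists 3; field.
- by exists (-2); field.
Qed.

(** The bound 5 is Cauchy-Schwarz for a unit vector against a vector of norm 5; already 3 has square
    9. *)
Lemma odd_sqr_le5 (R : realType) (a : R) :
  (a + 1) / 2 \is a Num.int -> a ^+ 2 <= 5 -> a = 1 \/ a = -1.
Proof.
move=> /intrP[m am]; have -> : a = (2 * m - 1)%:~R.
  by rewrite rmorphB rmorphM /= -am; field.
rewrite -rmorphXn /= (ler_int _ _ 5) => m5.
have [->|->] : m = 1 \/ m = 0 by nia.
  by left.
by right.
Qed.

(* u = t + t' - x has norm 1; its products with Y are odd, hence equal to 1 or -1. *)
Lemma unit_vector_of_triple (R : realType) (Y : seq 'rV[R]_9) (x t t' : 'rV[R]_9) :
    odd_seq Y -> x \in Y -> t \in Y \/ - t \in Y -> t' \in Y \/ - t' \in Y ->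
    dotp x t = 3 -> dotp x t' = 3 -> dotp t t' = -1 ->
  exists2 u, dotp u u = 1 & {in Y, forall w, dotp u w = 1 \/ dotp u w = -1}.
Proof.
move=> [uY Y5 YO] xY tY t'Y xt xt' tt'.
have Yodd y w : y \in Y -> w \in Y -> dotp y w \in [:: 1; -1; 3; -3; 5; -5].
  move=> yY wY; have [->|/YO] := eqVneq y w; first by rewrite Y5 // !inE eqxx !orbT.
  by move=> /(_ yY wY); rewrite !inE => /or4P[] ->; rewrite ?orbT.
have odd y w : y \in Y \/ - y \in Y -> w \in Y -> (dotp y w + 1) / 2 \is a Num.int.
  move=> [yY|yY] wY; have := odd_int (Yodd _ _ yY wY) => //.
  rewrite dotpNl => h; have -> : (dotp y w + 1) / 2 = 1 - (- dotp y w + 1) / 2.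
    by field.
  by apply: rpredB h; apply: rpred1.
have n5 y : y \in Y \/ - y \in Y -> dotp y y = 5.
  by case=> /Y5 //; rewrite !dotp_lin opprK.
pose u := t + t' - x.
have u1 : dotp u u = 1.
  by rewrite !dotp_lin (dotpC t x) (dotpC t' x) (dotpC t' t) xt xt' tt' !n5 //; [ring | left].
exists u => // w wY; apply: odd_sqr_le5.
  rewrite (_ : _ / 2 = (dotp t w + 1) / 2 + (dotp t' w + 1) / 2 - (dotp x w + 1) / 2).
    by apply: rpredB; [apply: rpredD |]; apply: odd => //; left.
  by rewrite !dotp_lin; field.
by have := dotp_CS u w; rewrite u1 Y5 // mul1r.
Qed.

(** Compared with 1 for each y, the square is larger by 24 at y = x and by 8 at product 3 or -3. *)
Lemma sum_sqr_odd (R : realType) (Y : seq 'rV[R]_9) (x : 'rV[R]_9) :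
    odd_seq Y -> x \in Y ->
  \sum_(y <- Y) dotp x y ^+ 2 =
    (size Y)%:R + 24 + 8 * (count (fun y => (dotp x y == 3) || (dotp x y == -3)) Y)%:R.
Proof.
move=> [uY Y5 YO] xY; set a := fun y => _.
have c1 : count (pred1 x) Y = 1%N by rewrite count_uniq_mem ?xY.
have -> : 24 = 24 * (count (pred1 x) Y)%:R :> R by rewrite c1 mulr1.
rewrite -(count_predT Y) -!sum1_count !natr_sum !mulr_sumr.
rewrite [X in _ + X + _]big_mkcond [X in _ + _ + X]big_mkcond -!big_split /=.
apply: eq_big_seq => y yY.
have ne c d : 0 < (c - d) ^+ 2 -> (c == d :> R) = false.
  by apply: contraTF => /eqP ->; rewrite subrr expr0n ltxx.
have [->|yx] := eqVneq y x.
  by rewrite /a Y5 // !ne //=; lra.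
have := YO _ _ xY yY; rewrite eq_sym => /(_ yx).
by rewrite /a !inE => /or4P[] /eqP->; rewrite ?eqxx ?orbT ?ne /=; lra.
Qed.

(** Without a pair of product -1 each row sum is at most N + 24 + 8 * 45 = N + 384, and (5N)^2 <= 9
    N (N + 384) gives N <= 216. *)
Lemma odd_seq_dichotomy (R : realType) (Y : seq 'rV[R]_9) :
    odd_seq Y -> (size Y <= 216)%N \/
  exists2 u, dotp u u = 1 & {in Y, forall w, dotp u w = 1 \/ dotp u w = -1}.
Proof.
move=> oY; have [uY Y5 YO] := oY.
(* The factor is 1 or -1 and selects, of y and - y, the one with product 3 with x. *)
pose T x := [seq (dotp x y / 3) *: y |
              y <- [seq y <- Y | (dotp x y == 3) || (dotp x y == -3)]].
have TP x t : t \in T x -> [/\ dotp x t = 3, t \in Y \/ - t \in Y & dotp t t = 5].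
  move=> /mapP[y]; rewrite mem_filter => /andP[/orP[]/eqP xy yY] ->.
    by rewrite xy mulfV ?pnatr_eq0 // scale1r; split; [|left|apply: Y5].
  rewrite xy mulNr mulfV ?pnatr_eq0 // scaleN1r !dotp_lin !opprK xy opprK Y5 //.
  by split=> //; right.
have [|noT] := pselect (exists x t t',
    [/\ x \in Y, t \in T x, t' \in T x & dotp t t' = -1]).
  move=> [x [t [t' [xY /TP[xt tY _] /TP[xt' t'Y _] tt']]]]; right.
  exact: unit_vector_of_triple oY xY tY t'Y xt xt' tt'.
left.
(* Opposite vectors would have product -5. *)
have YN y z : y \in Y -> z \in Y -> y = - z -> False.
  move=> yY zY yz; have yz' : y != z.
    apply/eqP => E; have := Y5 _ yY; rewrite {1}yz -E dotpNl Y5 //; lra.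
  have := YO _ _ yY zY yz'; rewrite yz dotpNl Y5 //.
  by rewrite !inE => /or4P[] /eqP; lra.
have uT x : x \in Y -> uniq (T x).
  move=> xY; rewrite map_inj_in_uniq ?filter_uniq // => y z.
  rewrite !mem_filter => /andP[/orP[]/eqP-> yY] /andP[/orP[]/eqP-> zY];
    rewrite ?mulNr mulfV ?pnatr_eq0 // ?scaleN1r ?scale1r // => E.
  - by case: (YN _ _ yY zY E).
  - by case: (YN _ _ zY yY (esym E)).
  - exact: oppr_inj.
have sT x : x \in Y ->
    (count (fun y => (dotp x y == 3%R) || (dotp x y == (-3)%R)) Y <= 45)%N.
  move=> xY; have <- : size (T x) = count (fun y => (dotp x y == 3) || (dotp x y == -3)) Y.
    by rewrite size_map size_filter.
  apply: (@two_distance_bound _ x) => [|t /TP[]//|t t' tT t'T tt']; first exact: uT.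
  have [xt tY t5] := TP _ _ tT; have [xt' t'Y t'5] := TP _ _ t'T.
  have tN : dotp t t' != -1 by apply/eqP => tN; apply: noT; exists x, t, t'.
  (* This norm is 3 + 2 (t, t'), which rules out (t, t') = -3. *)
  have : 0 <= dotp (t + t' - x) (t + t' - x) by apply: dotp_ge0.
  rewrite !dotp_lin (dotpC t x) (dotpC t' x) (dotpC t' t) xt xt' t5 t'5 Y5 // => t3.
  suff : dotp t t' \in [:: 1; -1; 3; -3].
    rewrite !inE (negbTE tN) /= => /or3P[]/eqP; [by left|by right|lra].
  have N a : - a \in [:: 1; -1; 3; -3] -> a \in [:: 1; -1; 3; -3] :> bool.
    rewrite !inE => /or4P[] /eqP/(canRL opprK) ->;
      by rewrite ?opprK eqxx ?orbT.
  case: tY t'Y => [tY|tY] [t'Y|t'Y].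
  - exact: YO.
  - apply/N; rewrite -dotpNr; apply: YO => //; apply/eqP => E.
    by move: (dotp_ge0 (t - t')) xt; rewrite E dotpNr xt'; lra.
  - apply/N; rewrite -dotpNl; apply: YO => //; apply/eqP => E.
    by move: xt'; rewrite -E dotpNr xt; lra.
  - rewrite -[dotp t t']opprK -dotpNl -dotpNr; apply: YO => //.
    by rewrite (inj_eq oppr_inj).
have := frame_bound_full Y5.
have S : \sum_(x <- Y) \sum_(y <- Y) dotp x y ^+ 2 <= (size Y)%:R * ((size Y)%:R + 384).
  rewrite -[X in X%:R * _]sum1_size natr_sum mulr_suml [leLHS]big_seq [leRHS]big_seq.
  apply: ler_sum => x xY; rewrite mul1r sum_sqr_odd //.
  by move: (sT x xY); rewrite -(ler_nat R); lra.
rewrite -(ler_nat R); move: S; set N := (size Y)%:R; set A := \sum_(x <- Y) _ => SA SN.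
by rewrite leNgt; apply/negP => N216; nra.
Qed.

(** * Reduction to roots in eight dimensions *)

(** The Householder reflection in the hyperplane orthogonal to u - e exchanges u and e; u = e is
    treated apart, since the formula divides by the norm of u - e. *)
Lemma reflection_unit (R : realType) n (u e : 'rV[R]_n) :
  dotp u u = 1 -> dotp e e = 1 ->
  exists2 H : 'M[R]_n, orthogonal_mx H & u *m H = e.
Proof.
move=> u1 e1; have [->|ue] := eqVneq u e.
  by exists 1%:M; rewrite ?mulmx1 // /orthogonal_mx trmx1 mulmx1.
pose d := u - e.
have d0 : dotp d d != 0 by apply: contra_neq ue => /dotp_eq0/eqP; rewrite subr_eq0 => /eqP.
pose H := 1%:M - (2 / dotp d d) *: (d^T *m d).
have dd x : x *m (d^T *m d) = dotp x d *: d.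
  rewrite mulmxA [x *m _]mx11_scalar mul_scalar_mx -dotpE; reflexivity.
have HT : H^T = H by rewrite linearB linearZ /= trmx1 trmx_mul trmxK.
exists H; last first.
  rewrite mulmxBr mulmx1 -scalemxAr dd scalerA.
  have -> : 2 / dotp d d * dotp u d = 1.
    have E : dotp d d = 2 * dotp u d.
      by rewrite /d !dotp_lin (dotpC e u) u1 e1; ring.
    by rewrite mulrAC -E mulfV.
  by rewrite scale1r opprB addrC subrK.
rewrite /orthogonal_mx HT {2}/H mulmxBr mulmx1 -scalemxAr {1}/H mulmxBl mul1mx.
rewrite -scalemxAl -mulmxA dd -scalemxAr scalerA divfK // scalerBr scalerA.
rewrite mulr_natr mulr2n scalerDl; set K := (_ / _) *: _.
by rewrite (opprD K K) (addrA K) subrr sub0r opprK subrK.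
Qed.

Lemma dotp_row_mx (R : realType) m n (a c : 'rV[R]_m) (b d : 'rV[R]_n) :
  dotp (row_mx a b) (row_mx c d) = dotp a c + dotp b d.
Proof. by rewrite !dotpE tr_row_mx mul_row_col mxE. Qed.

(* Rotating u to the last basis vector, the vectors of Y become, up to sign,
   the [sqrt 2 p, 1] for the elements p of a set of roots. *)
Lemma odd_seq_roots (R : realType) (Y : seq 'rV[R]_9) (u : 'rV[R]_9) :
    odd_seq Y -> dotp u u = 1 ->
    {in Y, forall w, dotp u w = 1 \/ dotp u w = -1} ->
  exists (H : 'M[R]_(8 + 1)) (p : 'rV[R]_9 -> 'rV[R]_8),
    [/\ orthogonal_mx H, root_seq (map p Y)
      & {in Y, forall w, dotp u w *: w *m H = row_mx (Num.sqrt 2 *: p w) (const_mx 1)}].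
Proof.
move=> [uY Y5 YO] u1 uY1.
pose e : 'rV[R]_(8 + 1) := row_mx 0 (const_mx 1).
have dot1 (a b : R) : dotp (const_mx a : 'rV[R]_1) (const_mx b) = a * b.
  by rewrite /dotp big_ord1 !mxE.
have e1 : dotp e e = 1.
  by rewrite dotp_row_mx dot1 /dotp big1 ?add0r ?mulr1 // => i _; rewrite mxE mul0r.
have [H HH uH] := @reflection_unit R (8 + 1) u e u1 e1.
have s2 : Num.sqrt 2 ^+ 2 = 2 :> R by rewrite sqr_sqrtr.
have s20 : Num.sqrt 2 != 0 :> R by rewrite sqrtr_eq0 -ltNge.
pose p (w : 'rV[R]_9) : 'rV[R]_8 := (Num.sqrt 2)^-1 *: lsubmx (dotp u w *: w *m H).
have pE : {in Y, forall w, dotp u w *: w *m H = row_mx (Num.sqrt 2 *: p w) (const_mx 1)}.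
  move=> w wY; rewrite scalerA mulfV // scale1r -[LHS]hsubmxK; congr row_mx.
  have : dotp (dotp u w *: w *m H) e = 1.
    by rewrite -uH dotp_mul_orth // dotpZl (dotpC w); case: (uY1 _ wY) => ->; ring.
  rewrite -[dotp u w *: w *m H]hsubmxK dotp_row_mx {1}/dotp big1 ?add0r => [|i _].
    rewrite /dotp big_ord1 [const_mx _ _ _]mxE mulr1 row_mxKr => rw.
    by apply/rowP => i; rewrite ord1 rw mxE.
  by rewrite [X in _ * X]mxE mulr0.
have pp w w' : w \in Y -> w' \in Y ->
    dotp (p w) (p w') = (dotp u w * (dotp u w' * dotp w w') - 1) / 2.
  move=> wY w'Y; rewrite -dotpZr -dotpZl -(dotp_mul_orth _ _ HH) !pE //.
  rewrite dotp_row_mx dot1 (dotpZl (Num.sqrt 2)) (dotpZr (Num.sqrt 2)).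
  by rewrite mulrA -expr2 s2; field.
have p2 w : w \in Y -> dotp (p w) (p w) = 2.
  by move=> wY; rewrite pp // Y5 //; case: (uY1 _ wY) => ->; field.
(* The map k |-> (k - 1) / 2 sends 1, -1, 3, -3 to 0, -1, 1, -2; the value 2 is missing, so distinct
   vectors give distinct roots. *)
have ppne w w' : w \in Y -> w' \in Y -> w != w' ->
    dotp (p w) (p w') \in [:: 0; -1; 1; -2].
  move=> wY w'Y ww'; rewrite pp //; set k := dotp u w * _.
  have : k \in [:: 1; -1; 3; -3].
    move: (YO _ _ wY w'Y ww'); rewrite /k !inE => /or4P[] /eqP->;
      by case: (uY1 _ wY) => ->; case: (uY1 _ w'Y) => ->;
      rewrite ?mul1r ?mulN1r ?opprK eqxx ?orbT.
  have E c : k - 1 = 2 * c -> (k - 1) / 2 = c by move=> ->; field.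
  rewrite !inE => /or4P[] /eqP kE.
  - by rewrite (E 0) ?eqxx // kE; ring.
  - by rewrite (E (-1)) ?eqxx ?orbT // kE; ring.
  - by rewrite (E 1) ?eqxx ?orbT // kE; ring.
  - by rewrite (E (-2)) ?eqxx ?orbT // kE; ring.
exists H, p; split=> //; split=> [|_ /mapP[w wY ->]|_ _ /mapP[w wY ->] /mapP[w' w'Y ->]].
- rewrite map_inj_in_uniq // => w w' wY w'Y ww'; apply/eqP/negPn/negP => /(ppne _ _ wY w'Y).
  by rewrite -ww' p2 // !inE => /or4P[] /eqP; lra.
- exact: p2.
have [->|/(ppne _ _ wY w'Y)] := eqVneq w w'; first by rewrite p2 // natr_int.
by rewrite !inE => /or4P[] /eqP->; rewrite ?rpredN ?rpred0 ?rpred1 ?natr_int.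
Qed.

(** * Scaling between the unit sphere and norm 5, and the conclusion *)

Lemma odd_seq_scale (R : realType) (s : seq 'rV[R]_9) :
    uniq s -> [set` s] `<=` unit_sphere R 9 ->
    inner_products [set` s] `<=` [set 1 / 5; - (1 / 5); 3 / 5; - (3 / 5)] ->
  odd_seq [seq Num.sqrt 5 *: x | x <- s].
Proof.
move=> us s1 sA; have s5 : Num.sqrt 5 * Num.sqrt 5 = 5 :> R by rewrite -expr2 sqr_sqrtr.
have s50 : Num.sqrt 5 != 0 :> R by rewrite sqrtr_eq0 -ltNge.
split=> [|_ /mapP[x xs ->]|_ _ /mapP[x xs ->] /mapP[y ys ->] xy].
- by rewrite map_inj_uniq // => x y /scalerI; apply.
- by rewrite dotpZl dotpZr mulrA s5 (s1 x xs) mulr1.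
have {}xy : x <> y by move=> E; rewrite E eqxx in xy.
rewrite dotpZl dotpZr mulrA s5.
have : inner_products [set` s] (dotp x y) by exists x, y.
have E (a b : R) : a = b / 5 -> 5 * a = b by move=> ->; field.
move=> /sA[[[|]|]|] /= h; rewrite !inE.
- by rewrite (E _ 1) ?eqxx.
- by rewrite (E _ (-1)) ?eqxx ?orbT // h mulNr.
- by rewrite (E _ 3) ?eqxx ?orbT.
- by rewrite (E _ (-3)) ?eqxx ?orbT // h mulNr.
Qed.

Lemma odd_seq_le (R : realType) (Y : seq 'rV[R]_9) : odd_seq Y -> (size Y <= 240)%N.
Proof.
move=> oY; have [Y216|[u u1 uY]] := odd_seq_dichotomy oY; first by apply: leq_trans Y216 _.
have [H [p [_ /root_seq_le[+ _] _]]] := odd_seq_roots oY u1 uY.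
by rewrite size_map.
Qed.

Lemma odd_seq_scale_equivalent (R : realType) (s : seq 'rV[R]_9) :
    odd_seq [seq Num.sqrt 5 *: x | x <- s] -> size s = 240%N ->
  equivalent [set` s] (X9 R).
Proof.
set Y := map _ _ => oY s240; have Y240 : size Y = 240%N by rewrite size_map.
have [|[u u1 uY]] := odd_seq_dichotomy oY; first by rewrite Y240.
have [H [p [HH rP pE]]] := odd_seq_roots oY u1 uY.
have [|K KK KP] := root_seq240_E8 rP; first by rewrite size_map.
(* [B] applies [K] to the first eight coordinates and fixes the last. *)
pose B : 'M[R]_(8 + 1) := block_mx K 0 0 1%:M.
have BB : B *m B^T = 1%:M.
  rewrite tr_block_mx mulmx_block !trmx0 trmx1 !mulmx0 !mul0mx KK mulmx1.
  by rewrite !addr0 !add0r -scalar_mx_block.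
have s50 : Num.sqrt 5 != 0 :> R by rewrite sqrtr_eq0 -ltNge.
pose Q : 'M[R]_(8 + 1) := H *m B.
(* On [s] this sign is the product with u, so that every image has positive last coordinate. *)
pose sg (x : 'rV[R]_9) := dotp u (Num.sqrt 5 *: x) == -1.
have sgE x : x \in s -> (-1) ^+ sg x = dotp u (Num.sqrt 5 *: x).
  move=> xs; rewrite /sg; have [->|->] := uY _ (map_f _ xs); last by rewrite eqxx expr1.
  rewrite (_ : _ == _ = false) ?expr0 //; apply/eqP; lra.
have xQ x : x \in s -> (-1) ^+ sg x *: (x *m Q) =
    row_mx (Num.sqrt (2 / 5) *: (p (Num.sqrt 5 *: x) *m K)) (const_mx (Num.sqrt (1 / 5))).
  move=> xs; rewrite sgE // /Q; set w := Num.sqrt 5 *: x.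
  (* Undoing the scaling by sqrt 5 turns sqrt 2 and 1 into sqrt (2/5) and sqrt (1/5). *)
  have -> : dotp u w *: (x *m (H *m B)) =
      (Num.sqrt 5)^-1 *: (dotp u w *: w *m H *m B).
    set a := dotp u w; rewrite /w.
    by rewrite -!scalemxAl !scalerA mulrCA mulVf // mulr1 mulmxA.
  rewrite pE ?map_f //.
  rewrite mul_row_block !mulmx0 addr0 add0r mulmx1 scale_row_mx -scalemxAl scalerA.
  rewrite sqrtrM // sqrtrV // mulrC; congr row_mx.
  by apply/rowP => i; rewrite !mxE mulr1 div1r sqrtrV.
exists Q, sg; split; first by rewrite /orthogonal_mx trmx_mul mulmxA -(mulmxA H) BB mulmx1.
apply/seteqP; split=> [_ [v Ev <-]|_ [x xs <-]].
  have /mapP[_ /mapP[x xs ->] vE] : v *m K^T \in map p Y.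
    by apply/KP; rewrite -mulmxA (mulmx1C KK) mulmx1.
  by exists x => //; rewrite xQ // -vE -mulmxA (mulmx1C KK) mulmx1.
rewrite xQ //; exists (p (Num.sqrt 5 *: x) *m K) => //.
by apply/KP; rewrite map_f // map_f.
Qed.

Unset Implicit Arguments.

Theorem theorem6p5 (R : realType) (X : set 'rV[R]_9)
    (sphX : X `<=` unit_sphere R 9)
    (angX : inner_products X `<=` [set 1 / 5; - (1 / 5); 3 / 5; - (3 / 5)]) :
  X #<= `I_240 /\ (X #= `I_240 -> equivalent X (X9 R)).
Proof.
have oddX (A : {fset 'rV[R]_9}) : [set` A] `<=` X ->
    odd_seq [seq Num.sqrt 5 *: x | x <- enum_fset A].
  move=> AX; apply: odd_seq_scale => [|x /AX/sphX//|a [x [y [/AX Xx /AX Xy xy ->]]]].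
    exact: fset_uniq.
  by apply: angX; exists x, y.
have leX (A : {fset 'rV[R]_9}) : [set` A] `<=` X -> (size (enum_fset A) <= 240)%N.
  by move=> /oddX/odd_seq_le; rewrite size_map.
have /finite_fsetP[A XA] : finite_set X.
  (* An infinite [X] would contain a finite subset of at least 241 elements, against [leX]. *)
  apply: contrapT => /(@infinite_set_fset _ X 241)[A AX].
  by rewrite leqNgt ltnS leX.
have AX : [set` A] `<=` X by rewrite XA.
have AI : X #= `I_(size (enum_fset A)) by rewrite XA; apply/card_eq_fsetP.
split=> [|X240]; first by rewrite (card_le_eql AI) card_le_II leX.
rewrite {1}XA; apply: odd_seq_scale_equivalent (oddX _ AX) _.
by apply/card_eq_fsetP; rewrite -XA.
Qed.
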